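(* For all $m \in \mathbb{Z}^+$, \[ \log_2 \Upsilon_m \le \frac{m}{\log_q m}\cdot\left(1 + O\!\left(\frac{\log_q\log_q m}{\log_q m}\right)\right), \] where the constant hidden in the $O(\cdot)$ term is absolute (independent of $m$ and $q$).
   Context: $\mathbb{F}$ is a finite field with $q$ elements. $\mathcal{P}_m$ denotes the set of monic polynomials in $\mathbb{F}[x]$ of degree at most $m$. For a monic $s(x)$, $\Phi(s)$ is the number of distinct monic divisors of $s(x)$ (equivalently, its distinct divisors in $\mathcal{P}_m$). Define $\Upsilon_m = \max_{s \in \mathcal{P}_m} \Phi(s)$.
   Formalization: The case m = 1 is excluded, because log_q m = 0 there and both m/log_q m and log_q log_q m are undefined; the O-term is read as an error of absolute value at most C·|log_q log_q m / log_q m| for all m ≥ 2, with C absolute. *)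

(* Defs.v *)
From HB Require Import structures.
From mathcomp Require Import all_boot all_order all_algebra all_field.
From mathcomp Require Import reals exp.

Set Implicit Arguments.
Unset Strict Implicit.
Unset Printing Implicit Defensive.

Import Order.TTheory GRing.Theory Num.Theory.
Local Open Scope ring_scope.

(* Intended for monic s: {poly_n F} is the finite type of polynomials of size
   at most n, i.e. degree less than n, so taking n = size s (degree plus one)
   loses no divisor of s. *)
Definition Phi (F : finFieldType) (s : {poly F}) : nat :=
  #|[set d : {poly_(size s) F} |
      ((d : {poly F}) \is monic) && ((d : {poly F}) %| s)]|.

(* The index ranges over all monic polynomials of degree at most m. *)
Definition Upsilon (F : finFieldType) (m : nat) : nat :=
  \max_(s : {poly_(m.+1) F} | (s : {poly F}) \is monic) Phi s.

(* Junk values: ln x = 0 for x <= 0 and x / 0 = 0, so this is the base-b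
   logarithm only for 0 < x and 0 < b, b != 1. *)
Definition logb (R : realType) (b x : R) : R := ln x / ln b.

(* Main.v *)
(* Removing from s a prime power p^e exactly dividing it divides the number of
   divisors by at most e + 1, so log_2 Phi(s) is at most the sum of
   log_2(1 + e_p). By LP duality, if log_2(1 + e) <= lam e + W for all e and
   lam (n + 1) >= 1, the primes of degree d > n cost at most lam per unit of
   degree and those of degree d <= n at most W more; counting all the monic
   polynomials of degree d, q^d of them, in place of the primes gives
   log_2 Upsilon_m <= lam m + W (q + ... + q^n).
   Put u = ln q and L = log_q m; the error term is S = ln L / (u L). The choices
   of lam are: 1 if L <= 1, or if u L^2 is bounded; 3/4 if L is just above 1;
   1/2 for the other L < 2; and otherwise 1/t, where t = L (1 - 4 S) if L >= u,
   while for L < u, t is floor(L) or floor(L) + 1, according to whether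
   (L - floor(L)) u is smaller or larger than 16 ln L. *)
Require Import Defs.
From HB Require Import structures.
From mathcomp Require Import all_boot all_order all_algebra all_field.
From mathcomp Require Import reals sequences exp.
From mathcomp Require Import lra ring zify.

Set Implicit Arguments.
Unset Strict Implicit.
Unset Printing Implicit Defensive.

Import Order.TTheory GRing.Theory Num.Theory.
Local Open Scope ring_scope.

(** * Divisor counts and irreducible factors *)

Lemma monic_divisor_mulXn (F : fieldType) (p r d : {poly F}) e :
  irreducible_poly p -> p \is monic -> d \is monic -> d %| p ^+ e * r ->
  exists k d', [/\ (k <= e)%N, d' \is monic, d' %| r & d = p ^+ k * d'].
Proof.
move=> p_irr p_monic; elim: e d => [|e IHe] d d_monic.
  by rewrite expr0 mul1r => d_r; exists 0%N, d; rewrite expr0 mul1r.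
have [/dvdpP[d1 d_def]|p'd] := boolP (p %| d).
  have d1_monic : d1 \is monic by rewrite -(monicMr _ p_monic) -d_def.
  rewrite d_def mulrC exprS -mulrA dvdp_mul2l ?monic_neq0 // => /IHe.
  case=> // k [d' [le_ke d'_monic d'_r ->]]; exists k.+1, d'.
  by rewrite exprS mulrA.
have /coprimep_expr d_cop : coprimep d p.
  by rewrite coprimep_sym irreducible_poly_coprime.
by rewrite Gauss_dvdpr // => d_r; exists 0%N, d; rewrite expr0 mul1r.
Qed.

(** The map [(k, d') |-> p ^+ k * d'] covers all monic divisors of [p ^+ e * r], and surjectivity is
    enough for an upper bound. *)
Lemma Phi_mulXn (F : finFieldType) (p r : {poly F}) e :
  irreducible_poly p -> p \is monic -> r \is monic ->
  (Phi (p ^+ e * r) <= e.+1 * Phi r)%N.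
Proof.
move=> p_irr p_monic r_monic; set s := p ^+ e * r.
have s_neq0 : s != 0 by rewrite monic_neq0 // monicMr ?monic_exp.
rewrite /Phi -[e.+1]card_ord -cardsT -cardsX.
set D := (X in (_ <= #|X|)%N).
pose f (x : 'I_e.+1 * {poly_(size r) F}) : {poly_(size s) F} :=
  npolyp (size s) (p ^+ x.1 * x.2).
apply: leq_trans (leq_imset_card f D); apply/subset_leq_card/subsetP => d.
rewrite inE => /andP[d_monic d_s].
have [k [d' [le_ke d'_monic d'_r d_def]]] :=
  monic_divisor_mulXn p_irr p_monic d_monic d_s.
have size_d' : (size d' <= size r)%N by rewrite dvdp_leq ?monic_neq0.
apply/imsetP; exists (Ordinal (le_ke : (k < e.+1)%N), npolyp (size r) d').
  by rewrite !inE npolypK // d'_monic.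
by apply/val_inj; rewrite /f /= npolypK -?d_def ?npolypK // -d_def dvdp_leq.
Qed.

Lemma monic_irreducible_divisor (F : finFieldType) (s : {poly F}) :
  s \is monic -> (1 < size s)%N ->
  exists p : {poly F}, [/\ irreducible_poly p, p \is monic & p %| s].
Proof.
move=> s_monic s_gt1.
pose P (d : {poly_(size s) F}) :=
  [&& (d : {poly F}) \is monic, (1 < size d)%N & (d : {poly F}) %| s].
have Ps : P (npolyp (size s) s) by rewrite /P npolypK // s_monic s_gt1 dvdpp.
case: (arg_minnP (fun d : {poly_(size s) F} => size d) Ps).
move=> p /and3P[p_monic p_gt1 p_s] p_min.
exists p; split=> //; split=> // q q_neq1 q_p.
have q_neq0 : q != 0 by apply: dvdpN0 q_p _; rewrite monic_neq0.
have q_gt1 : (1 < size q)%N.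
  by rewrite ltn_neqAle eq_sym q_neq1 size_poly_gt0.
have lq : (lead_coef q)^-1 != 0 by rewrite invr_eq0 lead_coef_eq0.
have size_q : (size q <= size s)%N.
  by rewrite dvdp_leq ?monic_neq0 // (dvdp_trans q_p).
rewrite -dvdp_size_eqp // eqn_leq dvdp_leq ?monic_neq0 //=.
(* Minimality only concerns monic divisors, so [q] is first divided by its leading coefficient. *)
have := p_min (npolyp (size s) ((lead_coef q)^-1 *: q)).
rewrite /P npolypK size_scale //; apply.
rewrite q_gt1 dvdpZl // (dvdp_trans q_p) // !andbT.
by rewrite monicE lead_coefZ mulVf // lead_coef_eq0.
Qed.

Lemma max_power_dvdp (F : fieldType) (p s : {poly F}) :
  (1 < size p)%N -> s != 0 ->
  exists e r, s = p ^+ e * r /\ ~~ (p %| r).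
Proof.
move=> p_gt1; have [n] := ubnP (size s); elim: n s => // n IHn s lt_sn s_neq0.
have [/dvdpP[s1 s_def]|p's] := boolP (p %| s); last first.
  by exists 0%N, s; rewrite expr0 mul1r.
have p_neq0 : p != 0 by rewrite -size_poly_gt0 ltnW.
have s1_neq0 : s1 != 0 by apply: contraNneq s_neq0 => s1_0; rewrite s_def s1_0 mul0r.
have lt_s1n : (size s1 < n)%N.
  rewrite (leq_trans _ (lt_sn : (size s <= n)%N)) // s_def size_mul //.
  by rewrite -ltnS prednK ?addn_gt0 ?size_poly_gt0 ?s1_neq0 // -addn2 leq_add2l.
have [e [r [s1_def p'r]]] := IHn s1 lt_s1n s1_neq0.
by exists e.+1, r; rewrite s_def s1_def exprSr mulrAC.
Qed.

Lemma Phi1 (F : finFieldType) : Phi (1 : {poly F}) = 1%N.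
Proof.
pose one := npolyp (size (1 : {poly F})) (1 : {poly F}).
have <- : #|[set one]| = 1%N by rewrite cards1.
apply: eq_card => d; rewrite !inE dvdp1 -val_eqE /= npolypK //.
apply/idP/eqP => [/andP[d_monic /eqP d_1]| ->]; last first.
  by rewrite monic1 size_poly1.
have d_const := size1_polyC (eq_leq d_1).
by move: d_monic; rewrite d_const monicE lead_coefC => /eqP ->.
Qed.

Lemma Phi_gt0 (F : finFieldType) (s : {poly F}) : s != 0 -> (0 < Phi s)%N.
Proof.
move=> s_neq0; apply/card_gt0P; exists (npolyp (size s) 1).
by rewrite inE npolypK ?size_poly1 ?size_poly_gt0 // monic1 dvd1p.
Qed.

(** * The duality bound *)

(** Weak duality: [lam] is the price of a unit of degree and [w d] a surcharge for each prime of
    degree [d]. The sum runs over all nonconstant monic divisors, an overcount that [w_ge0] makes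
    harmless. [N] is kept apart from [size s] so that the index type is the same throughout the
    induction. *)
Lemma ln_Phi_le (R : realType) (F : finFieldType) (lam : R) (w : nat -> R) :
  (forall d, 0 <= w d) ->
  (forall d e, (0 < d)%N -> ln e.+1%:R <= lam * d%:R * e%:R + w d) ->
  forall N (s : {poly F}), s \is monic -> (size s <= N)%N ->
  ln (Phi s)%:R <= lam * (size s).-1%:R +
    \sum_(p : {poly_N F} | [&& (p : {poly F}) \is monic, (1 < size p)%N &
                              (p : {poly F}) %| s]) w (size p).-1.
Proof.
move=> w_ge0 ln_le N s; have [n] := ubnP (size s).
elim: n s => // n IHn s lt_sn s_monic le_sN.
have [s_gt1|s_le1] := ltnP 1 (size s); last first.
  have s_const := size1_polyC s_le1.
  have -> : s = 1.
    by move: s_monic; rewrite s_const monicE lead_coefC => /eqP ->.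
  by rewrite Phi1 ln1 size_poly1 mulr0 add0r sumr_ge0.
have [p [p_irr p_monic p_s]] := monic_irreducible_divisor s_monic s_gt1.
have s_neq0 := monic_neq0 s_monic; have p_neq0 := monic_neq0 p_monic.
have p_gt1 : (1 < size p)%N by case: p_irr.
have [e [r [s_def p'r]]] := max_power_dvdp p_gt1 s_neq0.
have e_gt0 : (0 < e)%N.
  by case: e s_def => // s_r; move: p'r; rewrite expr0 mul1r in s_r; rewrite -s_r p_s.
have p_deg : (0 < (size p).-1)%N by rewrite -ltnS (ltn_predK p_gt1).
have pe_monic : p ^+ e \is monic by rewrite monic_exp.
have r_monic : r \is monic by rewrite -(monicMl _ pe_monic) -s_def.
have r_neq0 := monic_neq0 r_monic.
have size_s : (size s).-1 = ((size p).-1 * e + (size r).-1)%N.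
  rewrite s_def size_mul ?expf_neq0 // -(size_exp p e).
  have := size_poly_gt0 (p ^+ e); have := size_poly_gt0 r.
  rewrite r_neq0 expf_neq0 //.
  by case: (size r) => // a _; case: (size (p ^+ e)) => // b _; rewrite addSn addnS.
have lt_rs : (size r < size s)%N.
  have : (0 < size s)%N by rewrite size_poly_gt0.
  have : (0 < size r)%N by rewrite size_poly_gt0.
  move: size_s; case: (size s) => // a; case: (size r) => // b /= -> _ _.
  by rewrite ltnS -addn1 addnC leq_add2r muln_gt0 p_deg.
have r_s : r %| s by rewrite s_def dvdp_mull.
have := IHn r (leq_trans lt_rs lt_sn) r_monic (leq_trans (ltnW lt_rs) le_sN).
have p_N : (size p <= N)%N by rewrite (leq_trans _ le_sN) // dvdp_leq.
rewrite [X in _ -> _ <= _ + X](bigD1 (npolyp N p)) /=; last first.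
  by rewrite npolypK // p_monic p_gt1.
rewrite npolypK // size_s natrD natrM.
set A := (X in ln _ <= _ + X -> _); set B := (X in _ -> _ <= _ + (_ + X)).
(* Divisors of [r] divide [s], and [p] is not among them, so the term of [p] is left over to pay for
   [p ^+ e]. *)
have le_AB : A <= B.
  rewrite /A /B [in X in _ <= X]big_mkcond [in X in X <= _]big_mkcond.
  apply: ler_sum => d _; case: ifP => [/and3P[d_monic d_gt1 d_r]|_].
    rewrite d_monic d_gt1 (dvdp_trans d_r r_s) /=; case: eqP => //= d_def.
    by move: p'r; rewrite -[p](npolypK p_N) -d_def d_r.
  by case: ifP.
have := ln_le (size p).-1 e p_deg.
have Phi_s : (Phi s)%:R <= e.+1%:R * (Phi r)%:R :> R.
  by rewrite -natrM ler_nat s_def Phi_mulXn.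
have Phi_s_gt0 : 0 < (Phi s)%:R :> R by rewrite ltr0n Phi_gt0.
have Phi_r_gt0 : 0 < (Phi r)%:R :> R by rewrite ltr0n Phi_gt0.
have : ln (Phi s)%:R <= ln (e.+1%:R * (Phi r)%:R : R).
  by rewrite ler_ln ?posrE ?mulr_gt0 // ltr0n.
rewrite lnM ?posrE ?ltr0n ?Phi_gt0 //.
move: (ln _) (ln _) (ln _) => a b c; nra.
Qed.

(** Truncation below degree [d] forgets only the leading coefficient, which is 1. *)
Lemma card_monic_size (F : finFieldType) N d :
  (#|[set p : {poly_N F} | ((p : {poly F}) \is monic) && (size p == d.+1)]|
     <= #|F| ^ d)%N.
Proof.
rewrite -(card_npoly F d); set A := [set p | _].
have inj : {in A &, injective (fun p : {poly_N F} => npolyp d p)}.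
  move=> p p'; rewrite !inE => /andP[/monicP p_monic /eqP size_p].
  case/andP=> /monicP p'_monic /eqP size_p' eq_pp'; apply/npolyP => i.
  have [lt_id|lt_di|->] := ltngtP i d.
  - by have /npolyP/(_ i) := eq_pp'; rewrite !coef_npolyp lt_id.
  - by rewrite !nth_default ?size_p ?size_p'.
  - by move: p_monic p'_monic; rewrite !lead_coefE size_p size_p' => -> ->.
by rewrite -(card_in_imset inj) max_card.
Qed.

Lemma ln_succ_le (R : realType) (e : nat) : ln e.+1%:R <= ln 2 * e%:R :> R.
Proof.
rewrite mulr_natr -lnXn // ler_ln ?posrE ?exprn_gt0 ?ltr0n //.
by rewrite -natrX ler_nat ltn_expl.
Qed.

Lemma ln_Upsilon_le (R : realType) (F : finFieldType) (m n : nat) (lam W : R) :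
  0 <= lam -> 0 <= W -> (forall e, ln e.+1%:R <= lam * e%:R + W) ->
  ln 2 <= lam * n.+1%:R ->
  ln (Upsilon F m)%:R <= lam * m%:R + W * \sum_(1 <= d < n.+1) #|F|%:R ^+ d.
Proof.
move=> lam_ge0 W_ge0 ln_le ln2_le.
set T := \sum_(_ <= _ < _) _.
have T_ge0 : 0 <= T by rewrite sumr_ge0 // => i _; rewrite exprn_ge0.
have B_ge0 : 0 <= lam * m%:R + W * T by rewrite addr_ge0 ?mulr_ge0.
rewrite /Upsilon; elim/big_ind: _ => [|x y le_x le_y|s s_monic].
(* The neutral element of the maximum is 0, and [ln 0] is 0 by convention. *)
- by rewrite ln0.
- by case: (leqP x y).
pose w d : R := if (d <= n)%N then W else 0.
have w_ge0 d : 0 <= w d by rewrite /w; case: ifP.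
have w_le d e : (0 < d)%N -> ln e.+1%:R <= lam * d%:R * e%:R + w d.
  move=> d_gt0; rewrite /w; case: leqP => [_|lt_nd].
    rewrite (le_trans (ln_le e)) // lerD2r ler_wpM2r // ler_peMr //.
    by rewrite ler1n.
  rewrite addr0 (le_trans (ln_succ_le R e)) // ler_wpM2r //.
  by rewrite (le_trans ln2_le) // ler_wpM2l // ler_nat.
apply: le_trans (ln_Phi_le w_ge0 w_le s_monic (size_npoly s)) _.
apply: lerD.
  by rewrite ler_wpM2l // ler_nat; have := size_npoly s; case: size.
(* Divisibility by [s] is dropped here: all monic polynomials of degree [d] are counted. *)
pose A d := [set p : {poly_m.+1 F} | ((p : {poly F}) \is monic) && (size p == d.+1)].
have le_sum : \sum_(p : {poly_m.+1 F} | [&& (p : {poly F}) \is monic,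
     (1 < size p)%N & (p : {poly F}) %| s]) w (size p).-1 <=
   \sum_(p : {poly_m.+1 F}) \sum_(1 <= d < n.+1) (if p \in A d then W else 0).
  rewrite big_mkcond; apply: ler_sum => p _; case: ifP => [/and3P[p_m p_gt1 _]|_].
    rewrite /w; case: leqP => [le_pn|_]; last first.
      by apply: sumr_ge0 => d _; case: ifP.
    rewrite (bigD1_seq (size p).-1) ?iota_uniq //=; last first.
      by rewrite mem_index_iota ltnS le_pn andbT -ltnS (ltn_predK p_gt1).
    rewrite inE p_m (ltn_predK p_gt1) eqxx lerDl.
    by apply: sumr_ge0 => d _; case: ifP.
  by apply: sumr_ge0 => d _; case: ifP.
apply: le_trans le_sum _; rewrite exchange_big /= mulr_sumr.
apply: ler_sum => d _; rewrite -big_mkcond /= sumr_const -[_ *+ _]mulr_natr.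
by rewrite ler_wpM2l // -natrX ler_nat card_monic_size.
Qed.

(** * Logarithm estimates and the choices of the multiplier *)

Lemma ln_le_sub1 (R : realType) (x : R) : 0 < x -> ln x <= x - 1.
Proof. by move=> x_gt0; rewrite -[x in ln x](subrKC 1) le_ln1Dx //; lra. Qed.

Lemma ln_ge_1subV (R : realType) (x : R) : 0 < x -> 1 - x^-1 <= ln x.
Proof.
move=> x_gt0; have := @ln_le_sub1 R x^-1; rewrite invr_gt0 lnV ?posrE //.
by move=> /(_ x_gt0); lra.
Qed.

Lemma ln2_bounds (R : realType) : (1 / 2 <= ln 2 :> R) && (ln 2 <= 1 :> R).
Proof.
have := @ln_ge_1subV R 2 ltac:(lra); have := @ln_le_sub1 R 2 ltac:(lra).
by move=> *; lra.
Qed.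

Lemma logb2_Upsilon_le (R : realType) (F : finFieldType) (m n : nat) (lam W : R) :
  0 <= lam -> 0 <= W ->
  (forall e, ln e.+1%:R <= ln 2 * (lam * e%:R + W)) -> 1 <= lam * n.+1%:R ->
  logb 2 (Upsilon F m)%:R <= lam * m%:R + W * \sum_(1 <= d < n.+1) #|F|%:R ^+ d.
Proof.
have /andP[ln2_ge _] := ln2_bounds R; have ln2_gt0 : 0 < ln 2 :> R by lra.
move=> lam_ge0 W_ge0 ln_le lam_ge; rewrite /logb ler_pdivrMr // mulrC mulrDr !mulrA.
apply: ln_Upsilon_le; rewrite ?mulr_ge0 ?(ltW ln2_gt0) //.
  by move=> e; rewrite -!mulrA -mulrDr.
by rewrite -mulrA ler_peMr // ltW.
Qed.

Lemma logb2_Upsilon_le_deg (R : realType) (F : finFieldType) (m : nat) :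
  logb 2 (Upsilon F m)%:R <= m%:R :> R.
Proof.
have -> : m%:R = 1 * m%:R + 0 * \sum_(1 <= d < 1) #|F|%:R ^+ d :> R by ring.
by apply: logb2_Upsilon_le => // [e|]; rewrite mul1r ?addr0 ?ln_succ_le.
Qed.

(** This is log_2(1 + e) <= (3e + 1)/4, an equality at e = 1. *)
Lemma expn4_succ_le e : (e.+1 ^ 4 <= 2 ^ (3 * e).+1)%N.
Proof.
(* Each step gains a factor 8 on the right, too little to pass from 0 to 1 (a factor 16 on the left)
   but enough from 1 on. *)
case: e => // e; elim: e => // e IHe.
have -> : (3 * e.+2 = 3 + 3 * e.+1)%N by rewrite mulnS.
rewrite -addnS expnD; apply: leq_trans (leq_mul (leqnn _) IHe).
by rewrite !expnS expn0; nia.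
Qed.

Lemma logb2_Upsilon_le_34 (R : realType) (F : finFieldType) (m : nat) :
  logb 2 (Upsilon F m)%:R <= 3 / 4 * m%:R + 1 / 4 * #|F|%:R :> R.
Proof.
have := @logb2_Upsilon_le R F m 1 (3 / 4) (1 / 4).
rewrite big_nat1 expr1; apply; [lra|lra| |lra].
move=> e; have : ln (e.+1%:R ^+ 4) <= ln (2 ^+ (3 * e).+1) :> R.
  by rewrite ler_ln ?posrE ?exprn_gt0 ?ltr0n // -!natrX ler_nat expn4_succ_le.
rewrite !lnXn ?ltr0n //.
rewrite -[ln e.+1%:R *+ _]mulr_natr -[_ *+ (3 * e).+1]mulr_natr -[(3 * e).+1%:R]natr1 natrM.
by move=> ?; lra.
Qed.

Lemma sum_expr_le (R : realType) (q : R) n : 2 <= q ->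
  \sum_(1 <= d < n.+1) q ^+ d <= 2 * q ^+ n.
Proof.
move=> q_ge2; elim: n => [|n IHn]; first by rewrite big_geq // expr0; lra.
rewrite big_nat_recr //= exprS.
have : 0 <= q ^+ n by apply: exprn_ge0; lra.
by nra.
Qed.

(** The multiplier is [1 / t]. A surcharge of order [ln t] would do; [4 * t] is simpler and affects
    only the tail, where powers of [L] can be spared. *)
Lemma logb2_Upsilon_le_threshold (R : realType) (F : finFieldType) (m n : nat)
    (t : R) : 1 <= t -> t <= n.+1%:R ->
  logb 2 (Upsilon F m)%:R <= m%:R / t + 8 * t * #|F|%:R ^+ n :> R.
Proof.
move=> t_ge1 le_tn; have t_gt0 : 0 < t by lra.
have /andP[ln2_ge ln2_le] := ln2_bounds R.
have ln2_gt0 : 0 < ln 2 :> R by lra.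
have q_ge2 : 2 <= #|F|%:R :> R by rewrite ler_nat card_finNzRing_gt1.
have := @logb2_Upsilon_le R F m n t^-1 (4 * t).
rewrite [t^-1 * m%:R]mulrC => bound; apply: le_trans (bound _ _ _ _) _.
- by rewrite invr_ge0 ltW.
- lra.
- move=> e; set x : R := e.+1%:R; have x_gt0 : 0 < x by rewrite ltr0n.
  (* [ln x = ln (x ln 2 / t) + ln (t / ln 2)]; bound both by [ln y <= y - 1]. *)
  have := ln_le_sub1 (divr_gt0 (mulr_gt0 x_gt0 ln2_gt0) t_gt0).
  have := ln_le_sub1 (divr_gt0 t_gt0 ln2_gt0).
  rewrite !ln_div ?lnM ?posrE ?mulr_gt0 // => h1 h2.
  (* The 4 comes from [ln 2 >= 1/2]. *)
  have h3 : t / ln 2 <= 4 * t * ln 2.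
    have : 1 <= 4 * (ln 2 * ln 2) :> R by nra.
    by rewrite ler_pdivrMr //; nra.
  have h4 : ln 2 / t <= 1 by rewrite ler_pdivrMr //; lra.
  have -> : ln 2 * (t^-1 * e%:R + 4 * t) = x * ln 2 / t - ln 2 / t + 4 * t * ln 2.
    by rewrite /x -natr1; field; rewrite gt_eqF.
  by lra.
- by rewrite mulrC ler_pdivlMr // mul1r.
- rewrite lerD2l (_ : 8 * t * _ = 4 * t * (2 * #|F|%:R ^+ n)); last by ring.
  by rewrite ler_wpM2l ?sum_expr_le //; lra.
Qed.

(** * Analytic estimates, one for each range of [u] and [L] *)

Lemma expRN_le (R : realType) (x : R) : 0 <= x -> expR (- x) <= (1 + x)^-1.
Proof.
move=> x_ge0; rewrite expRN lef_pV2 ?posrE ?expR_gt0 ?expR_ge1Dx //; lra.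
Qed.

Lemma expRN_ln (R : realType) (x : R) n : 0 < x -> expR (- (n%:R * ln x)) = (x ^+ n)^-1.
Proof. by move=> x_gt0; rewrite expRN expRM_natl lnK. Qed.

Lemma bound_of_factor (R : realType) (U m L S c X : R) :
  0 < m -> 0 < L -> U <= m * X -> X <= L^-1 + c * (S / L) ->
  U <= m / L * (1 + c * S).
Proof.
move=> m_gt0 L_gt0 U_le X_le; apply: (le_trans U_le).
rewrite -mulrA ler_pM2l // (le_trans X_le) // le_eqVlt; apply/orP; left.
by apply/eqP; field; rewrite gt_eqF.
Qed.

(** The error term alone absorbs the loss: c ln L / (u L^2) >= ln L >= 1 - 1/L. *)
Lemma bound_trivial (R : realType) (U m u L c : R) :
  0 < m -> 0 < u -> 1 < L -> U <= m -> u * L ^+ 2 <= c ->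
  U <= m / L * (1 + c * (ln L / u / L)).
Proof.
move=> m_gt0 u_gt0 L_gt1 U_le c_ge; have L_gt0 : 0 < L by lra.
apply: (@bound_of_factor _ _ _ _ _ _ 1); rewrite ?mulr1 //.
have lnL := ln_ge_1subV L_gt0.
have lnL_ge0 : 0 <= ln L by rewrite ln_ge0 // ltW.
have h : u * L ^+ 2 * ((1 - L^-1) / u / L / L) <= c * (ln L / u / L / L).
  apply: ler_pM => //.
  - by rewrite mulr_ge0 ?exprn_ge0 // ltW.
  - by rewrite !divr_ge0 ?(ltW L_gt0) ?(ltW u_gt0) // subr_ge0 invf_le1 // ltW.
  - by rewrite !ler_wpM2r // invr_ge0 ltW.
have e : u * L ^+ 2 * ((1 - L^-1) / u / L / L) = 1 - L^-1.
  by field; rewrite !gt_eqF.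
by lra.
Qed.

Lemma expR_le_div (R : realType) (u L : R) : 0 <= u -> 1 <= L ->
  expR u <= expR (L * u) / (1 + (L - 1) * u).
Proof.
move=> u_ge0 L_ge1; have x_ge0 : 0 <= (L - 1) * u by rewrite mulr_ge0 ?subr_ge0.
rewrite [X in expR X <= _](_ : u = L * u + - ((L - 1) * u)); last by ring.
by rewrite expRD ler_wpM2l ?expR_ge0 ?expRN_le.
Qed.

(* Here [q = expR u] and [m = expR (L * u)] with [1 < L <= 7/6]: the linear
   factors still dominate, and only the coefficient [1/4] of [q], together with
   [q / m <= 1 / (1 + (L - 1) u)], beats the loss [1 - 1/L]. *)
Lemma bound_near_one (R : realType) (U u L : R) :
  12 <= u -> 1 < L -> L - 1 <= 1 / 6 ->
  U <= 3 / 4 * expR (L * u) + 1 / 4 * expR u ->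
  U <= expR (L * u) / L * (1 + 0 * (ln L / u / L)).
Proof.
move=> u_ge L_gt1 L_le U_le; have L_gt0 : 0 < L by lra.
apply: (@bound_of_factor _ _ _ _ _ _ (3 / 4 + 1 / 4 * (1 + (L - 1) * u)^-1)).
- exact: expR_gt0.
- exact: L_gt0.
- apply: (le_trans U_le).
  by have := @expR_le_div _ u L ltac:(lra) (ltW L_gt1); lra.
- rewrite mul0r addr0.
  have x_gt0 : 0 < 1 + (L - 1) * u by nra.
  rewrite -(ler_pM2r L_gt0) mulVf ?gt_eqF // -(ler_pM2r x_gt0) mul1r.
  rewrite (_ : _ * _ * _ = (3 / 4 * (1 + (L - 1) * u) + 1 / 4) * L); last first.
    by field; rewrite gt_eqF.
  set d := L - 1 in x_gt0 L_le *; have -> : L = 1 + d by rewrite /d; ring.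
  have d_gt0 : 0 < d by rewrite /d; lra.
  have : 0 <= d * ((u - 12) * (1 - 6 * d)) by rewrite !mulr_ge0; lra.
  by nra.
Qed.

(** The threshold 2 is free, as 1/2 <= 1/L. With [L] away from 1, both q/m and the error term have
    order 1/u. *)
Lemma bound_below_two (R : realType) (U u L : R) :
  0 < u -> 1 / 6 <= L - 1 -> L <= 2 ->
  U <= expR (L * u) / 2 + 8 * 2 * expR u ^+ 1 ->
  U <= expR (L * u) / L * (1 + 2688 * (ln L / u / L)).
Proof.
move=> u_gt0 L_ge L_le U_le; have L_gt0 : 0 < L by lra.
apply: (@bound_of_factor _ _ _ _ _ _ (1 / 2 + 96 / u)).
- exact: expR_gt0.
- exact: L_gt0.
- apply: (le_trans U_le); rewrite expr1.
  have := @expR_le_div _ u L (ltW u_gt0) ltac:(lra).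
  have : (1 + (L - 1) * u)^-1 <= 6 / u.
    by rewrite -[6 / u]invrK lef_pV2 ?posrE ?invr_gt0 ?divr_gt0 ?invfM ?invrK; nra.
  rewrite -(ler_pM2l (expR_gt0 (L * u))); lra.
- have h1 : 1 / 2 <= L^-1 by rewrite mul1r lef_pV2 ?posrE.
  have h2 : 1 / 7 <= ln L.
    apply: le_trans (ln_ge_1subV L_gt0).
    have : L^-1 <= (7 / 6)^-1 by rewrite lef_pV2 ?posrE //; lra.
    by lra.
  (* [2688 = 96 * 28], from [ln L >= 1/7] and [L ^+ 2 <= 4]. *)
  have h3 : 96 / u <= 2688 * (ln L / u / L / L).
    rewrite (_ : 2688 * _ = (2688 * ln L / L ^+ 2) / u); last by field; rewrite !gt_eqF.
    rewrite ler_wpM2r ?invr_ge0 ?(ltW u_gt0) // ler_pdivlMr ?exprn_gt0 //.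
    by rewrite expr2; nra.
  by lra.
Qed.

Lemma ln_ge_half (R : realType) (L : R) : 2 <= L -> 1 / 2 <= ln L.
Proof.
move=> L_ge; have /andP[ln2_ge _] := ln2_bounds R.
by rewrite (le_trans ln2_ge) // ler_ln ?posrE //; lra.
Qed.

Lemma bound_large (R : realType) (U u L : R) :
  1 / 2 <= u -> u <= L -> 1024 <= L ->
  (forall n (t : R), 1 <= t -> t <= n.+1%:R ->
     U <= expR (L * u) / t + 8 * t * expR u ^+ n) ->
  U <= expR (L * u) / L * (1 + 24 * (ln L / u / L)).
Proof.
move=> u_ge le_uL L_ge U_le; have L_gt0 : 0 < L by lra.
have u_gt0 : 0 < u by lra.
set S := ln L / u / L; have lnL := @ln_ge_half _ L ltac:(lra).
have S_ge : 1 / (2 * (u * L)) <= S.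
  rewrite (_ : 1 / (2 * (u * L)) = 1 / 2 / u / L); last by field; rewrite !gt_eqF.
  by rewrite /S !ler_wpM2r // invr_ge0 ltW.
have S_ge0 : 0 <= S by apply: le_trans S_ge; rewrite divr_ge0 ?mulr_ge0 // ltW.
have S_le : S <= 1 / 8.
  (* From ln L = 2 ln r <= 2r and u >= 1/2 follows S <= 4/r, hence the requirement L >= 32^2. *)
  set r := Num.sqrt L; have r_gt0 : 0 < r by rewrite sqrtr_gt0.
  have rr : r * r = L by rewrite -expr2 sqr_sqrtr // ltW.
  have r_ge : 32 <= r by nra.
  have lnr : ln L = 2 * ln r by rewrite -rr lnM ?posrE //; ring.
  have lnr_le := ln_le_sub1 r_gt0.
  rewrite /S -mulrA -invfM ler_pdivrMr ?mulr_gt0 // lnr -{1}rr.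
  have : 1 / 2 * (r * r) <= u * (r * r) by rewrite ler_wpM2r //; nra.
  by nra.
(* Since S L u = ln L, this makes q^t = m / L^4, while 1/t exceeds 1/L by at most 8 S/L. *)
pose t := L * (1 - 4 * S).
have t_ge : L / 2 <= t by rewrite /t; nra.
have t_le : t <= L by rewrite /t; nra.
have t_gt0 : 0 < t by lra.
have /andP[le_nt lt_tn] := truncn_itv (ltW t_gt0).
set n := Num.truncn t in le_nt lt_tn.
have qn : expR u ^+ n <= expR (L * u) * (L ^+ 4)^-1.
  rewrite -expRM_natl -(expRN_ln 4) // -expRD ler_expR.
  rewrite (_ : L * u + _ = t * u); first by rewrite ler_wpM2r // ltW.
  by rewrite /t /S; field; rewrite !gt_eqF.
apply: (@bound_of_factor _ _ _ _ _ _ (t^-1 + 8 * L * (L ^+ 4)^-1)).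
- exact: expR_gt0.
- exact: L_gt0.
- apply: le_trans (U_le n t ltac:(lra) (ltW lt_tn)) _.
  rewrite mulrDr lerD2l [leRHS]mulrCA.
  by apply: ler_pM => //; rewrite ?exprn_ge0 ?expR_ge0 //; lra.
- have h1 : t^-1 <= L^-1 + 8 * (S / L).
    rewrite -[t^-1]mul1r ler_pdivrMr // /t.
    rewrite [leRHS](_ : _ = (1 + 8 * S) * (1 - 4 * S)); last by field; rewrite gt_eqF.
    by nra.
  (* S >= 1/(2 u L) >= 1/(2 L^2), because u <= L. *)
  have h2 : 8 * L * (L ^+ 4)^-1 <= 16 * (S / L).
    rewrite ler_pdivrMr ?exprn_gt0 //.
    rewrite [leRHS](_ : _ = 16 * S * L ^+ 3); last by field; rewrite gt_eqF.
    have h3 : 1 / 2 <= S * (u * L).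
      have : 1 / (2 * (u * L)) * (u * L) <= S * (u * L).
        by rewrite ler_wpM2r // mulr_ge0 // ltW.
      rewrite (_ : 1 / (2 * (u * L)) * (u * L) = 1 / 2) //.
      by field; rewrite !gt_eqF.
    have h4 : S * (u * L) <= S * (L * L) by rewrite ler_wpM2l // ler_wpM2r // ltW.
    have : 1 / 2 * L <= S * (L * L) * L by rewrite ler_wpM2r ?(ltW L_gt0) //; lra.
    by rewrite !exprS expr0; lra.
  by lra.
Qed.

Lemma expRN_le_pow4 (R : realType) (u : R) : 0 < u -> expR (- u) <= 24 / u ^+ 4.
Proof.
move=> u_gt0; rewrite expRN -[24 / _]invrK lef_pV2 ?posrE ?expR_gt0 ?invr_gt0 //.
  rewrite invfM invrK mulrC; have := expR_ge1Dxn 3 (ltW u_gt0).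
  by rewrite (_ : 4`! = 24)%N //; lra.
by rewrite divr_gt0 ?exprn_gt0.
Qed.

(** With t = N = floor(L), the loss 1/N - 1/L is at most 32 S/L because (L - N) u <= 16 ln L = 16 S
    L u. The surcharged degrees stop at N - 1, so the tail carries a factor e^(-u), negligible as u
    >= L. *)
Lemma bound_just_above_integer (R : realType) (U u L : R) n :
  2 <= L -> L <= u -> n.+1%:R <= L -> L <= n.+2%:R ->
  (L - n.+1%:R) * u <= 16 * ln L ->
  (forall k (t : R), 1 <= t -> t <= k.+1%:R ->
     U <= expR (L * u) / t + 8 * t * expR u ^+ k) ->
  U <= expR (L * u) / L * (1 + 416 * (ln L / u / L)).
Proof.
move=> L_ge le_Lu; set N : R := n.+1%:R => le_NL le_LN du_le U_le.
have L_gt0 : 0 < L by lra.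
have u_gt0 : 0 < u by lra.
have N_ge1 : 1 <= N by rewrite ler1n.
have {}le_LN : L <= N + 1 by rewrite natr1.
have lnL := ln_ge_half L_ge.
set S := ln L / u / L.
have S_ge0 : 0 <= S by rewrite /S !divr_ge0 ?ltW //; lra.
have SLu : S * L * u = ln L by rewrite /S; field; rewrite !gt_eqF.
have qn : expR u ^+ n <= expR (L * u) * (24 / u ^+ 4).
  apply: le_trans (_ : expR (L * u) * expR (- u) <= _); last first.
    by rewrite ler_wpM2l ?expR_ge0 ?expRN_le_pow4.
  rewrite -expRM_natl -expRD ler_expR.
  have -> : L * u + - u = (L - 1) * u by ring.
  by rewrite ler_wpM2r ?(ltW u_gt0) // lerBrDr natr1.
apply: (@bound_of_factor _ _ _ _ _ _ (N^-1 + 8 * L * (24 / u ^+ 4))).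
- exact: expR_gt0.
- exact: L_gt0.
- apply: le_trans (U_le n N N_ge1 (lexx _)) _.
  rewrite mulrDr lerD2l [leRHS]mulrCA.
  by apply: ler_pM => //; rewrite ?exprn_ge0 ?expR_ge0 //; lra.
- have h1 : N^-1 <= L^-1 + 32 * (S / L).
    have h : L - N <= 16 * (S * L).
      by rewrite -(ler_pM2r u_gt0) (le_trans du_le) // -SLu; lra.
    rewrite -[N^-1]mul1r ler_pdivrMr; last by lra.
    rewrite -(ler_pM2r L_gt0) mul1r.
    rewrite [leRHS](_ : _ = N + 32 * S * N); last by field; rewrite gt_eqF.
    have : 0 <= S * (2 * N - L) by rewrite mulr_ge0 //; lra.
    by nra.
  have h2 : 8 * L * (24 / u ^+ 4) <= 384 * (S / L).
    rewrite [leLHS](_ : _ = 192 * L / u ^+ 4); last by field; rewrite gt_eqF.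
    rewrite ler_pdivrMr ?exprn_gt0 //.
    have LL : L * L <= u * u by rewrite ler_pM // ltW.
    have LLL : L * L * L <= u * u * u by rewrite ler_pM ?mulr_ge0 // ltW.
    rewrite -(ler_pM2r (mulr_gt0 L_gt0 L_gt0)).
    rewrite [leRHS](_ : _ = 384 * (S * L * u) * (u * u * u)); last first.
      by field; rewrite gt_eqF.
    rewrite SLu; have : ln L * (L * L * L) <= ln L * (u * u * u).
      by rewrite ler_wpM2l //; lra.
    have : 1 / 2 * (L * L * L) <= ln L * (L * L * L).
      by rewrite ler_wpM2r // !mulr_ge0 // ltW.
    by lra.
  by apply: le_trans (lerD h1 h2) _; move: (S / L) => x; lra.
Qed.

(** With t = n + 1 the main term gains (1 - d)/(L (n + 1)), where d = L - n, and this must pay for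
    the tail q^n / m = e^(-du). Half of the exponent yields L^(-8); the other half yields [v^-1], at
    most 1 - d + 2/u. The part 1 - d matches the gain, which vanishes as d tends to 1, and 2/u goes
    into the error term. *)
Lemma bound_above_integer (R : realType) (U u L : R) n :
  2 <= L -> 0 < u -> n%:R <= L -> L <= n.+1%:R ->
  16 * ln L <= (L - n%:R) * u ->
  (forall k (t : R), 1 <= t -> t <= k.+1%:R ->
     U <= expR (L * u) / t + 8 * t * expR u ^+ k) ->
  U <= expR (L * u) / L * (1 + 2 * (ln L / u / L)).
Proof.
move=> L_ge u_gt0; set N : R := n%:R => le_NL le_LN du_ge U_le.
have L_gt0 : 0 < L by lra.
have {}le_LN : L <= N + 1 by rewrite natr1.
have lnL := ln_ge_half L_ge.
set d := L - N in du_ge; have d_ge0 : 0 <= d by rewrite /d; lra.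
have d_le1 : d <= 1 by rewrite /d; lra.
have du_ge0 : 0 <= d * u by rewrite mulr_ge0 // ltW.
pose v := 1 + d * u / 2; have v_gt0 : 0 < v by rewrite /v; lra.
have qn : expR u ^+ n <= expR (L * u) * ((L ^+ 8)^-1 * v^-1).
  rewrite -expRM_natl (_ : n%:R * u = L * u + (- (d * u / 2) + - (d * u / 2))).
    rewrite !expRD ler_wpM2l ?expR_ge0 // ler_pM ?expR_ge0 ?expRN_le //; last by lra.
    by rewrite -expRN_ln // ler_expR; lra.
  by rewrite /d /N; field.
have v_le : v^-1 <= 1 - d + 2 / u.
  rewrite -[v^-1]mul1r ler_pdivrMr //.
  rewrite [leRHS](_ : _ = 1 - d + d * (1 - d) * u / 2 + 2 / u + d).
    have : 0 <= d * (1 - d) * u by rewrite !mulr_ge0 //; lra.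
    have : 0 <= 2 / u by rewrite divr_ge0 // ltW.
    by lra.
  by rewrite /v; field; rewrite gt_eqF.
have tail : 8 * (N + 1) * ((L ^+ 8)^-1 * v^-1) <= (1 - d + 2 / u) / (2 * L ^+ 2).
  have L5 : 32 <= L ^+ 5 by rewrite (_ : 32 = 2 ^+ 5) ?lerXn2r ?nnegrE //; [lra|ring].
  have c_le : 8 * (N + 1) * (L ^+ 8)^-1 <= (2 * L ^+ 2)^-1.
    rewrite ler_pdivrMr ?exprn_gt0 //.
    rewrite [leRHS](_ : _ = L ^+ 5 * L / 2); last by field; rewrite gt_eqF.
    have : 32 * L <= L ^+ 5 * L by rewrite ler_wpM2r // ltW.
    by lra.
  rewrite mulrA mulrC [leRHS]mulrC mulrC; apply: ler_pM => //.
  - by rewrite mulr_ge0 ?invr_ge0 ?exprn_ge0 //; lra.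
  - by rewrite invr_ge0 ltW.
apply: (@bound_of_factor _ _ _ _ _ _ ((N + 1)^-1 + 8 * (N + 1) * ((L ^+ 8)^-1 * v^-1))).
- exact: expR_gt0.
- exact: L_gt0.
- have N1_ge1 : 1 <= N + 1 by rewrite lerDr ler0n.
  have le_N1 : N + 1 <= n.+1%:R by rewrite natr1.
  apply: le_trans (U_le n (N + 1) N1_ge1 le_N1) _.
  rewrite [leRHS]mulrDr lerD2l [leRHS]mulrCA.
  by apply: ler_wpM2l => //; lra.
- have gap : (1 - d) / (2 * L ^+ 2) <= L^-1 - (N + 1)^-1.
    rewrite (_ : L^-1 - _ = (1 - d) / (L * (N + 1))); last first.
      by rewrite /d; field; rewrite !gt_eqF //; lra.
    apply: ler_wpM2l; first by lra.
    by rewrite lef_pV2 ?posrE ?mulr_gt0 ?exprn_gt0 //; nra.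
  have rest : 2 / u / (2 * L ^+ 2) <= 2 * (ln L / u / L / L).
    rewrite [leLHS](_ : _ = 1 / u / L / L); last by field; rewrite !gt_eqF.
    rewrite !mulrA !ler_wpM2r ?invr_ge0 ?(ltW u_gt0) ?(ltW L_gt0) //; lra.
  by move: tail; rewrite mulrDl; lra.
Qed.

Lemma bound_weaken (R : realType) (U m u L c C : R) :
  0 < m -> 0 < u -> 1 <= L -> c <= C ->
  U <= m / L * (1 + c * (ln L / u / L)) -> U <= m / L * (1 + C * (ln L / u / L)).
Proof.
move=> m_gt0 u_gt0 L_ge1 le_cC U_le; have L_gt0 : 0 < L by lra.
apply: (le_trans U_le).
apply: ler_wpM2l; first by rewrite divr_ge0 // ltW.
by rewrite lerD2l ler_wpM2r // !divr_ge0 ?ln_ge0 // ltW.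
Qed.

Lemma bound_all (R : realType) (U u L : R) :
  1 / 2 <= u -> 1 < L ->
  U <= expR (L * u) ->
  U <= 3 / 4 * expR (L * u) + 1 / 4 * expR u ->
  (forall n (t : R), 1 <= t -> t <= n.+1%:R ->
     U <= expR (L * u) / t + 8 * t * expR u ^+ n) ->
  U <= expR (L * u) / L * (1 + 1024 ^+ 3 * (ln L / u / L)).
Proof.
move=> u_ge L_gt1 U_le U_le34 U_le_t.
have u_gt0 : 0 < u by lra. have L_gt0 : 0 < L by lra.
have m_gt0 := expR_gt0 (L * u).
have C_ge : 2688 <= 1024 ^+ 3 :> R by rewrite !exprS expr0; lra.
have weaken c : c <= 2688 -> U <= expR (L * u) / L * (1 + c * (ln L / u / L)) ->
    U <= expR (L * u) / L * (1 + 1024 ^+ 3 * (ln L / u / L)).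
  by move=> le_c; apply: bound_weaken => //; [lra | apply: le_trans C_ge].
have [L_lt2|L_ge2] := ltP L 2.
  have [u_lt12|u_ge12] := ltP u 12.
    apply: bound_trivial => //; apply: le_trans C_ge; rewrite expr2.
    have : L * L <= 2 * 2 by rewrite ler_pM // ltW.
    by nra.
  have [d_le|d_gt] := leP (L - 1) (1 / 6).
    by apply: (weaken 0); [lra | apply: bound_near_one].
  apply: (weaken 2688) => //; apply: bound_below_two => //; try exact: ltW.
  by apply: U_le_t; lra.
have [le_uL|lt_Lu] := leP u L.
  have [L_lt|L_ge] := ltP L 1024.
    (* Here [u <= L < 1024], so [u * L ^+ 2] is below [1024 ^+ 3]; this case dictates the final
       constant. *)
    apply: bound_trivial => //; rewrite [leRHS]exprS ler_pM ?exprn_ge0 //; try lra.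
    by rewrite lerXn2r ?nnegrE //; lra.
  by apply: (weaken 24); [lra | apply: bound_large].
have := truncn_itv (ltW L_gt0).
have : (0 < Num.truncn L)%N by rewrite truncn_gt0 ltW.
case: (Num.truncn L) => // n _ /andP[le_nL /ltW le_Ln].
have [du_le|du_gt] := leP ((L - n.+1%:R) * u) (16 * ln L).
  apply: (weaken 416); first lra.
  exact: (@bound_just_above_integer _ _ _ _ n) (ltW lt_Lu) _ _ _ _.
apply: (weaken 2); first lra.
exact: (@bound_above_integer _ _ _ _ n.+1) u_gt0 le_nL le_Ln (ltW du_gt) U_le_t.
Qed.

(* The O-term is an error e bounded by an absolute constant C times
   |log_q log_q m / log_q m|; C is chosen before F and m. For m = 1 one has
   log_q m = 0 and the right-hand side is undefined, hence 1 < m. *)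
Theorem theorem1 (R : realType) :
  exists C : R, 0 < C /\
    forall (F : finFieldType) (m : nat), (1 < m)%N ->
      let q : R := #|F|%:R in
      exists e : R,
        `|e| <= C * `|logb q (logb q m%:R) / logb q m%:R| /\
        logb 2 (Upsilon F m)%:R <= m%:R / logb q m%:R * (1 + e).
Proof.
exists (1024 ^+ 3); split=> [|F m m_gt1 q]; first by rewrite exprn_gt0.
have C_ge0 : 0 <= 1024 ^+ 3 :> R by rewrite exprn_ge0.
have q_ge2 : 2 <= q by rewrite ler_nat card_finNzRing_gt1.
have m_gt0 : 0 < m%:R :> R by rewrite ltr0n ltnW.
pose u := ln q; have u_ge : 1 / 2 <= u by exact: ln_ge_half.
have u_gt0 : 0 < u by lra.
pose L := ln m%:R / u.
have L_gt0 : 0 < L by rewrite divr_gt0 // ln_gt0 // ltr1n.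
have mE : m%:R = expR (L * u) by rewrite /L divfK ?gt_eqF // lnK // posrE.
have qE : q = expR u by rewrite lnK // posrE; lra.
have U_le := logb2_Upsilon_le_deg R F m.
rewrite /logb -/u -/L in U_le *; set U := ln _ / ln 2 in U_le *.
have [L_le1|L_gt1] := leP L 1.
  (* For m <= q the trivial bound m is already at most m / L. *)
  exists 0; rewrite normr0 mulr_ge0 //; split=> //.
  by rewrite addr0 mulr1 (le_trans U_le) // ler_pdivlMr // ler_piMr // ltW.
exists (1024 ^+ 3 * (ln L / u / L)); rewrite normrM (ger0_norm C_ge0); split=> //.
rewrite mE; apply: bound_all => //; rewrite -mE //.
  by rewrite -qE; apply: logb2_Upsilon_le_34.
by move=> n t t_ge1 le_tn; rewrite -qE; apply: logb2_Upsilon_le_threshold.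
Qed.
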